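(* There is an absolute constant $c>0$ such that the following holds. Let $C\subseteq\{0,1\}^n$ be a binary linear code which is a perfect $3$-locally correctable code, i.e., for every coordinate $i\in[n]$, either $C^\perp$ contains the unit vector $e_i$, or $C^\perp$ contains at least $\delta n$ vectors of Hamming weight $4$ whose supports all contain $i$ and are pairwise disjoint apart from $i$, where $\delta = \frac{n-1}{3n}$. Then $\dim(C) \le c\sqrt{n}$.
   Context: $C^\perp$ denotes the dual code of $C$ over $\mathbb F_2$ with respect to the standard inner product. A $q$-locally correctable code with density parameter $\delta$ is called perfect when $\delta=\frac{n-1}{qn}$ (the largest possible value); here $q=3$. The paper states the conclusion as $\dim(C)\le O(\sqrt n)$. *)

(* Defs.v *)
From HB Require Import structures.
From mathcomp Require Import all_boot all_order all_algebra.
From mathcomp Require Import reals.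
Set Implicit Arguments.
Unset Strict Implicit.
Unset Printing Implicit Defensive.
Import Order.TTheory GRing.Theory Num.Theory.
Local Open Scope ring_scope.

Definition dotF2 (n : nat) (u v : 'rV['F_2]_n) : 'F_2 :=
  \sum_(i < n) u 0 i * v 0 i.

Definition dual_code (n : nat) (C : {vspace 'rV['F_2]_n}) :
    {set 'rV['F_2]_n} :=
  [set u | [forall (v : 'rV['F_2]_n | v \in C), dotF2 u v == 0]].

Definition unit_vec (n : nat) (i : 'I_n) : 'rV['F_2]_n := delta_mx 0 i.

Definition hsupp (n : nat) (u : 'rV['F_2]_n) : {set 'I_n} :=
  [set i | u 0 i != 0].

Definition hweight (n : nat) (u : 'rV['F_2]_n) : nat := #|hsupp u|.

(* [M] is the family of checks available for decoding coordinate [i]; as a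
   set, its members are pairwise distinct, and [#|M|] counts them. *)
Definition lcc_checks (n q : nat) (C : {vspace 'rV['F_2]_n}) (i : 'I_n)
    (M : {set 'rV['F_2]_n}) : Prop :=
  [/\ M \subset dual_code C,
      forall u, u \in M -> hweight u = q.+1,
      forall u, u \in M -> i \in hsupp u
    & forall u v, u \in M -> v \in M -> u != v ->
        [disjoint hsupp u :\ i & hsupp v :\ i]].

Definition locally_correctable (R : realType) (n q : nat) (delta : R)
    (C : {vspace 'rV['F_2]_n}) : Prop :=
  forall i : 'I_n,
    unit_vec i \in dual_code C \/
    exists M : {set 'rV['F_2]_n},
      lcc_checks q C i M /\ delta * n%:R <= #|M|%:R.

Definition perfect_density (R : realType) (n q : nat) : R :=
  (n%:R - 1) / (q%:R * n%:R).

Definition perfect_lcc (R : realType) (n q : nat)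
    (C : {vspace 'rV['F_2]_n}) : Prop :=
  locally_correctable q (perfect_density R n q) C.

(* Main.v *)
Require Import Defs.
From HB Require Import structures.
From mathcomp Require Import all_boot all_order all_algebra.
From mathcomp Require Import reals.
From mathcomp Require Import zify ring lra.
Set Implicit Arguments.
Unset Strict Implicit.
Unset Printing Implicit Defensive.
Import Order.TTheory GRing.Theory Num.Theory.
Local Open Scope ring_scope.

(* Shorten C one coordinate at a time: each shortening costs at most one
   dimension, enlarges the set F of coordinates vanishing on the subcode D, and
   merges classes of coordinates that agree on D. Give i outside F the level
   log |class of i|, give i in F a level just above the maximum, and let Psi be
   the sum of all levels. If x is not in F, the checks at x cover F, and every
   check raises Psi by at least the number of elements of F it contains: with
   c_x = c_j + c_a + c_b and c_j = 0, the classes of a and b merge and the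
   smaller one at least doubles. So Psi grows by |F| when shortening at x, while
   F grows by the class of x, which can be chosen of size about 2^(Psi/n). This
   is a discrete form of f' = 2^(Psi/n), Psi' = f, which blows up after
   O(sqrt n) steps; once |F| is of order n / log n, O(log^2 n) more steps suffice
   because Psi is O(n log n). *)

(** * Arithmetic in the two-element field *)

Lemma F2P (a : 'F_2) : a = 0 \/ a = 1.
Proof. by case: a => [[|[|]]] // i; [left | right]; apply/val_inj. Qed.

Lemma F2_addbb (a : 'F_2) : a + a = 0.
Proof. by case: (F2P a) => ->; apply/val_inj. Qed.

Lemma F2_add_eq0 (a b : 'F_2) : (a + b == 0) = (a == b).
Proof. by case: (F2P a) => ->; case: (F2P b) => ->. Qed.

(** * Shortened subcodes, agreement classes and levels *)

Section Shortening.

Variable n : nat.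
Implicit Types (D : {vspace 'rV['F_2]_n}) (i j x : 'I_n).

Definition zeros D : {set 'I_n} :=
  [set i | [forall c : 'rV['F_2]_n, (c \in D) ==> (c 0 i == 0)]].

Definition agree D i : {set 'I_n} :=
  [set j | [forall c : 'rV['F_2]_n, (c \in D) ==> (c 0 i == c 0 j)]].

(** Coordinate [x] is set to zero but not deleted, so all iterated shortenings are subcodes of the
    same length [n]. *)
Definition shorten D x : {vspace 'rV['F_2]_n} :=
  (D :&: lker (linfun (col x)))%VS.

(* The extra 2 pays for a check meeting [zeros D] in two coordinates: its third
   coordinate then joins the zeros. *)
Definition level D i : nat :=
  if i \in zeros D then (trunc_log 2 n).+2 else trunc_log 2 #|agree D i|.

Definition potential D : nat := (\sum_i level D i)%N.

Lemma zerosP D i :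
  reflect (forall c, c \in D -> c 0 i = 0) (i \in zeros D).
Proof.
rewrite inE; apply: (iffP forallP) => [H c cD|H c].
  by apply/eqP; have /implyP := H c; apply.
by apply/implyP => /H ->.
Qed.

Lemma agreeP D i j :
  reflect (forall c, c \in D -> c 0 i = c 0 j) (j \in agree D i).
Proof.
rewrite inE; apply: (iffP forallP) => [H c cD|H c].
  by apply/eqP; have /implyP := H c; apply.
by apply/implyP => /H ->.
Qed.

Lemma nzerosP D i : i \notin zeros D -> exists2 c, c \in D & c 0 i = 1.
Proof.
rewrite inE negb_forall => /existsP[c]; rewrite negb_imply => /andP[cD ci].
by exists c => //; case: (F2P (c 0 i)) ci => -> .
Qed.

Lemma mem_shorten D x (c : 'rV['F_2]_n) :
  (c \in shorten D x) = (c \in D) && (c 0 x == 0).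
Proof.
rewrite memv_cap memv_ker lfunE /=; congr (_ && _).
apply/eqP/eqP => [/matrixP/(_ 0 0)|cx]; first by rewrite !mxE.
by apply/matrixP => i j; rewrite !mxE (ord1 i).
Qed.

Lemma shorten_sub D x : (shorten D x <= D)%VS.
Proof. exact: capvSl. Qed.

Lemma dim_shorten D x : (\dim D <= (\dim (shorten D x)).+1)%N.
Proof.
have dimE := limg_ker_dim (linfun (col x)) D.
have dim1 := dimvS (subvf (linfun (col x) @: D)%VS).
rewrite dimvf /dim /= muln1 -(leq_add2l (\dim (shorten D x))) addn1 in dim1.
by apply: leq_trans dim1; rewrite -[leqLHS]dimE.
Qed.

Lemma dim_shorten_lt D x : x \notin zeros D -> (\dim (shorten D x) < \dim D)%N.
Proof.
move=> /nzerosP[c cD cx].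
rewrite ltnNge; apply/negP => le_dim.
have eqD : shorten D x = D.
  by apply/eqP; rewrite eqEdim shorten_sub.
by move: cD; rewrite -eqD mem_shorten cx andbF.
Qed.

Lemma zeros_lt D : D != 0%VS -> exists x, x \notin zeros D.
Proof.
move=> D0; apply/existsP; rewrite -negb_forall; apply: contra D0 => /forallP Z.
rewrite -subv0; apply/subvP => c cD; rewrite memv0.
by apply/eqP/rowP => i; rewrite mxE; exact: (zerosP _ _ (Z i)).
Qed.

Lemma disjoint_zeros_agree D x : x \notin zeros D -> [disjoint zeros D & agree D x].
Proof.
move=> xZ; rewrite disjoints_subset; apply/subsetP => i /zerosP iZ.
rewrite inE; apply: contra xZ => /agreeP xi; apply/zerosP => c cD.
by rewrite xi // iZ.
Qed.

(** Fix [d] in [D] with d_x = 1. If i vanishes on the subcode, then c_i = 0 when c_x = 0, and c_i =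
    d_i when c_x = 1, because c + d lies in the subcode. So on [D] coordinate i is either 0 or a
    copy of [x], according to d_i. *)
Lemma zeros_shorten D x : x \notin zeros D ->
  zeros (shorten D x) = zeros D :|: agree D x.
Proof.
move=> xZ; have [d dD dx] := nzerosP xZ.
apply/setP => i; rewrite in_setU; apply/idP/orP => [/zerosP iZ|].
  have ci c : c \in D -> c 0 x = 1 -> c 0 i = d 0 i.
    move=> cD cx; apply/eqP; rewrite -F2_add_eq0; apply/eqP.
    have /iZ : c + d \in shorten D x by rewrite mem_shorten rpredD //= mxE cx dx.
    by rewrite mxE.
  case: (F2P (d 0 i)) => di; [left; apply/zerosP|right; apply/agreeP] => c cD;
    by case: (F2P (c 0 x)) => cx; rewrite ?(ci c cD cx) ?cx //;
       apply/eqP; rewrite // ?[0 == _]eq_sym; apply/eqP; apply: iZ;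
       rewrite mem_shorten cD cx eqxx.
case=> [/zerosP iZ|/agreeP xi]; apply/zerosP => c;
  rewrite mem_shorten => /andP[cD /eqP cx]; first exact: iZ.
by rewrite -xi.
Qed.

Lemma card_zeros_shorten D x : x \notin zeros D ->
  #|zeros (shorten D x)| = (#|zeros D| + #|agree D x|)%N.
Proof.
move=> xZ; rewrite zeros_shorten // cardsU.
by rewrite (disjoint_setI0 (disjoint_zeros_agree xZ)) cards0 subn0.
Qed.

Lemma mem_agree D i : i \in agree D i.
Proof. exact/agreeP. Qed.

Lemma card_agree_gt0 D i : (0 < #|agree D i|)%N.
Proof. by apply/card_gt0P; exists i; apply: mem_agree. Qed.

Lemma agreeS D D' i : (D' <= D)%VS -> agree D i \subset agree D' i.
Proof.
move=> /subvP sD; apply/subsetP => j /agreeP ij.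
by apply/agreeP => c /sD; apply: ij.
Qed.

Lemma zerosS D D' : (D' <= D)%VS -> zeros D \subset zeros D'.
Proof.
move=> /subvP sD; apply/subsetP => j /zerosP ij.
by apply/zerosP => c /sD; apply: ij.
Qed.

Lemma trunc_log_agree D i : (trunc_log 2 #|agree D i| <= trunc_log 2 n)%N.
Proof. by apply: leq_trunc_log; rewrite -[leqRHS]card_ord max_card. Qed.

Lemma level_le D i : (level D i <= (trunc_log 2 n).+2)%N.
Proof.
by rewrite /level; case: ifP => // _; have := trunc_log_agree D i; lia.
Qed.

Lemma levelS D D' i : (D' <= D)%VS -> (level D i <= level D' i)%N.
Proof.
move=> sD; rewrite {2}/level; case: ifP => [_|iZ']; first exact: level_le.
rewrite /level; case: ifP => [/(subsetP (zerosS sD))|_]; first by rewrite iZ'.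
by apply: leq_trunc_log; apply/subset_leq_card/agreeS.
Qed.

Lemma level_agree D D' i : i \notin zeros D -> i \in zeros D' ->
  ((level D i).+2 <= level D' i)%N.
Proof.
rewrite /level => /negbTE -> ->; exact: trunc_log_agree.
Qed.

(** A coordinate that joins the zeros gains 2 by itself. Otherwise two disjoint classes end up
    inside one, which has at least twice the size of the smaller, so that one's logarithm rises. *)
Lemma level_merge D D' i j : (D' <= D)%VS ->
  i \notin zeros D -> j \notin zeros D ->
  j \notin agree D i -> j \in agree D' i ->
  (level D i + level D j < level D' i + level D' j)%N.
Proof.
move=> sD iZ jZ ij /agreeP ij'.
have li := levelS i sD; have lj := levelS j sD.
have [/(level_agree iZ)|iZ'] := boolP (i \in zeros D'); first by lia.
have [/(level_agree jZ)|jZ'] := boolP (j \in zeros D'); first by lia.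
move: li lj; rewrite /level !ifN //.
have disj : [disjoint agree D i & agree D j].
  rewrite disjoints_subset; apply/subsetP => k /agreeP ik; rewrite inE.
  by apply: contra ij => /agreeP jk; apply/agreeP => c cD; rewrite ik // jk.
have eqij : agree D' j = agree D' i.
  by apply/setP => k; apply/agreeP/agreeP => H c cD; rewrite -H // ij'.
have le_card : (#|agree D i| + #|agree D j| <= #|agree D' i|)%N.
  have := cardsU (agree D i) (agree D j).
  rewrite (disjoint_setI0 disj) cards0 subn0 => <-.
  by apply: subset_leq_card; rewrite subUset -{2}eqij !agreeS.
rewrite eqij => li lj.
have raise D1 k : (0 < #|agree D1 k|)%N -> (2 * #|agree D1 k| <= #|agree D' i|)%N ->
  (trunc_log 2 #|agree D1 k| < trunc_log 2 #|agree D' i|)%N.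
  by move=> k0 le2; rewrite -trunc_logMp //; apply: leq_trunc_log.
have [le_ij|/ltnW le_ji] := leqP #|agree D i| #|agree D j|.
  by have := raise D i (card_agree_gt0 _ _); lia.
by have := raise D j (card_agree_gt0 _ _); lia.
Qed.

(** Cases on how many members of [T] are zeros: three would put [x] in [zeros D]; two make the third
    vanish, a gain of 2; one makes the other two merge, a gain of 1; none asks only for
    monotonicity. *)
Lemma triple_gain D x (T : {set 'I_n}) : x \notin zeros D -> #|T| = 3%N ->
  (forall c, c \in D -> c 0 x = \sum_(i in T) c 0 i) ->
  (\sum_(i in T) (level D i + (i \in zeros D))
    <= \sum_(i in T) level (shorten D x) i)%N.
Proof.
move=> xZ T3 xT; have sD := shorten_sub D x.
have cx c : c \in shorten D x -> c 0 x = 0.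
  by rewrite mem_shorten => /andP[_ /eqP].
have pair i j : i \notin zeros D -> j \notin zeros D ->
    (forall c, c \in D -> c 0 x = c 0 i + c 0 j) ->
    (level D i + level D j < level (shorten D x) i + level (shorten D x) j)%N.
  move=> iZ jZ xij; apply: level_merge => //.
    have [c cD cx1] := nzerosP xZ; apply/negP => /agreeP/(_ c cD) cij.
    by have := xij c cD; rewrite cij F2_addbb cx1.
  apply/agreeP => c cD; apply/eqP; rewrite -F2_add_eq0 -xij ?cx //.
  exact: (subvP sD).
have single i : i \notin zeros D -> (forall c, c \in D -> c 0 x = c 0 i) ->
    ((level D i).+2 <= level (shorten D x) i)%N.
  move=> iZ xi; apply: level_agree => //; apply/zerosP => c cD.
  by rewrite -xi ?cx // (subvP sD).
move: T3 xT; rewrite cardE; case E: (enum T) => [|i [|j [|k [|]]]] //= _ xT.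
have {}xT c : c \in D -> c 0 x = c 0 i + (c 0 j + c 0 k).
  by move=> /xT ->; rewrite -big_enum /= E !big_cons big_nil addr0.
rewrite -!(big_enum _ _ T) /= E !big_cons !big_nil.
have := (levelS i sD, levelS j sD, levelS k sD) => -[[li lj] lk].
have [iZ|iZ] := boolP (i \in zeros D); have [jZ|jZ] := boolP (j \in zeros D);
  have [kZ|kZ] := boolP (k \in zeros D); rewrite ?addn0 ?addn1.
- case/negP: xZ; apply/zerosP => c cD.
  by rewrite xT // (zerosP _ _ iZ) // (zerosP _ _ jZ) // (zerosP _ _ kZ) // !addr0.
- suff /(single _ kZ) : forall c, c \in D -> c 0 x = c 0 k by lia.
  by move=> c cD; rewrite xT // (zerosP _ _ iZ) // (zerosP _ _ jZ) // !add0r.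
- suff /(single _ jZ) : forall c, c \in D -> c 0 x = c 0 j by lia.
  by move=> c cD; rewrite xT // (zerosP _ _ iZ) // (zerosP _ _ kZ) // add0r addr0.
- suff /(pair _ _ jZ kZ) : forall c, c \in D -> c 0 x = c 0 j + c 0 k by lia.
  by move=> c cD; rewrite xT // (zerosP _ _ iZ) // add0r.
- suff /(single _ iZ) : forall c, c \in D -> c 0 x = c 0 i by lia.
  by move=> c cD; rewrite xT // (zerosP _ _ jZ) // (zerosP _ _ kZ) // !addr0.
- suff /(pair _ _ iZ kZ) : forall c, c \in D -> c 0 x = c 0 i + c 0 k by lia.
  by move=> c cD; rewrite xT // (zerosP _ _ jZ) // add0r.
- suff /(pair _ _ iZ jZ) : forall c, c \in D -> c 0 x = c 0 i + c 0 j by lia.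
  by move=> c cD; rewrite xT // (zerosP _ _ kZ) // addr0.
- lia.
Qed.


End Shortening.

(** * From checks to partitions into triples, and the gain in potential *)

Definition triple_cover n (C : {vspace 'rV['F_2]_n}) (x : 'I_n)
    (P : {set {set 'I_n}}) : Prop :=
  partition P [set~ x] /\
  forall T, T \in P ->
    #|T| = 3%N /\ forall c, c \in C -> c 0 x = \sum_(i in T) c 0 i.

(** Removing [x] from the supports leaves disjoint triples; by perfect density they have at least n
    - 1 points in total, hence exhaust the other coordinates. *)
Lemma checks_triple_cover n (C : {vspace 'rV['F_2]_n}) x M :
  lcc_checks 3 C x M -> (n <= (3 * #|M|).+1)%N ->
  exists P, triple_cover C x P.
Proof.
move=> [/subsetP dualM wM xM disjM] leM.
pose F (u : 'rV['F_2]_n) := hsupp u :\ x.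
have F3 u : u \in M -> #|F u| = 3%N.
  move=> uM; have := cardsD1 x (hsupp u); rewrite xM // -/(F u).
  by have := wM u uM; rewrite /hweight => ->; case.
have F0 : set0 \notin [set F u | u in M].
  by apply/imsetP => -[u /F3] /[swap] <-; rewrite cards0.
have disjF : {in M &, forall u v, v != u -> [disjoint F u & F v]}.
  by move=> u v uM vM vu; apply: disjM; rewrite // eq_sym.
have [tP injF] := trivIimset disjF F0.
exists [set F u | u in M]; split.
  apply/and3P; split=> //; rewrite eqEcard; apply/andP; split.
    apply/bigcupsP => _ /imsetP[u _ ->]; apply/subsetP => i.
    by rewrite !inE => /andP[].
  rewrite cardsC1 card_ord -(eqP tP).
  by rewrite big_imset //= (eq_bigr (fun=> 3%N)) // sum_nat_const mulnC -subn1 leq_subLR add1n.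
move=> _ /imsetP[u uM ->]; split; first exact: F3.
move=> c cC; have := dualM u uM; rewrite inE => /forallP/(_ c).
rewrite cC => /eqP; rewrite /dotF2 => dot0.
apply/eqP; rewrite -F2_add_eq0; apply/eqP; rewrite -[RHS]dot0.
rewrite [RHS](bigID (mem (hsupp u))) /= [X in _ = _ + X]big1 ?addr0; last first.
  by move=> i; rewrite inE negbK => /eqP ->; rewrite mul0r.
have supp1 i : i \in hsupp u -> u 0 i * c 0 i = c 0 i.
  by rewrite inE; case: (F2P (u 0 i)) => -> //; rewrite mul1r.
by rewrite (eq_bigr _ supp1) (big_setD1 x (xM u uM)).
Qed.

(** Relations valid on [C] persist on [D], so the triples at [x] can be used after any number of
    shortenings; their gains add up because they partition the rest. *)
Lemma potential_gain n (C D : {vspace 'rV['F_2]_n}) x P :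
  (D <= C)%VS -> x \notin zeros D -> triple_cover C x P ->
  (potential D + #|zeros D| <= potential (shorten D x))%N.
Proof.
move=> /subvP sDC xZ [partP triP].
have -> : #|zeros D| = (\sum_i (i \in zeros D))%N.
  by rewrite -sum1_card big_mkcond; apply: eq_bigr => i _; case: (_ \in _).
rewrite /potential -big_split /= (bigD1 x) //= [leqRHS](bigD1 x) //=.
rewrite (negbTE xZ) addn0 leq_add ?levelS ?shorten_sub //.
have eqx i : (i != x) = (i \in [set~ x]) by rewrite !inE.
rewrite !(eq_bigl _ _ eqx) !(set_partition_big _ partP).
apply: leq_sum => T /triP[T3 xT]; apply: triple_gain => // c /sDC; exact: xT.
Qed.

Lemma potential_le n (D : {vspace 'rV['F_2]_n}) :
  (potential D <= (trunc_log 2 n).+2 * n)%N.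
Proof.
rewrite mulnC -[X in (X * _)%N]card_ord -sum_nat_const.
by apply: leq_sum => i _; apply: level_le.
Qed.

(** Any [x] of maximal level outside [zeros D] works. *)
Lemma large_class n (D : {vspace 'rV['F_2]_n}) : D != 0%VS ->
  exists2 x, x \notin zeros D
    & (potential D <= (trunc_log 2 n).+2 * #|zeros D| +
                     n * trunc_log 2 #|agree D x|)%N.
Proof.
move=> /zeros_lt[x0 x0Z].
case: (@arg_maxnP _ x0 (fun x => x \notin zeros D) (level D) x0Z) => x xZ maxx.
exists x => //; rewrite /potential (bigID (mem (zeros D))) /= leq_add //.
  by rewrite mulnC -sum_nat_const; apply: leq_sum => i _; apply: level_le.
have -> : trunc_log 2 #|agree D x| = level D x by rewrite /level ifN.
apply: (@leq_trans (\sum_(i < n | i \notin zeros D) level D x)).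
  exact: leq_sum.
rewrite sum_nat_const leq_mul2r; apply/orP; right.
by rewrite -[leqRHS]card_ord max_card.
Qed.

(** * Elementary inequalities *)

Lemma pow4_trunc_log n : (0 < n)%N -> ((trunc_log 2 n).+2 ^ 4 <= 100 * n)%N.
Proof.
move=> n0; apply: (leq_trans _ (leq_mul (leqnn 100%N) (@trunc_logP 2 n isT n0))).
(* Logarithms 0 to 3 are checked apart: the induction step needs (k+1)^4 <= 2 k^4, with k the
   logarithm plus 2, and this starts at k = 6. *)
move: (trunc_log 2 n); do 4![case=> //]; elim=> // l IH.
rewrite [(2 ^ _.+1)%N]expnS mulnCA.
apply: (leq_trans _ (leq_mul (leqnn 2%N) IH)); rewrite !expnS expn0; nia.
Qed.

Lemma bernoulli_ge (R : realFieldType) (a : R) m :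
  0 <= a -> 1 + m%:R * a <= (1 + a) ^+ m.
Proof.
move=> a0; elim: m => [|m IH]; first by rewrite mul0r addr0 expr0.
rewrite exprS; apply: (le_trans _ (ler_wpM2l _ IH)); last by lra.
have := ler0n R m; rewrite -natr1; nra.
Qed.

(** The bound (1+a)^m <= 1/(1-ma), multiplied out so that 1 - ma may have any sign. *)
Lemma bernoulli_le (R : realFieldType) (a : R) m :
  0 <= a -> (1 + a) ^+ m * (1 - m%:R * a) <= 1.
Proof.
move=> a0; elim: m => [|m IH]; first by rewrite mul0r subr0 expr0 mulr1.
apply: le_trans IH; rewrite exprSr -mulrA ler_wpM2l ?exprn_ge0 //; first by lra.
have := ler0n R m; rewrite -natr1; nra.
Qed.

(** * Counting the shortenings *)

Section Growth.

Variables (n : nat) (C : {vspace 'rV['F_2]_n}).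
Hypothesis n_gt0 : (0 < n)%N.
Hypothesis covered : forall x, x \notin zeros C -> exists P, triple_cover C x P.
Implicit Types D : {vspace 'rV['F_2]_n}.

Let K := (trunc_log 2 n).+2.

Lemma shorten_potential D x : (D <= C)%VS -> x \notin zeros D ->
  (potential D + #|zeros D| <= potential (shorten D x))%N.
Proof.
move=> sD xZ; have xZC : x \notin zeros C.
  by apply: contra xZ; apply/subsetP/zerosS.
by have [P /(potential_gain sD xZ)] := covered xZC.
Qed.

Lemma dim_many_zeros D : (D <= C)%VS -> (n <= K * #|zeros D|)%N ->
  (\dim D <= K ^ 2)%N.
Proof.
(* The left side never decreases under shortening: the dimension term loses at most [n], and the
   potential gains at least n / K. *)
move=> sD nD; suff : (\dim D * n + K * potential D <= K * (K * n))%N by nia.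
move: (leqnn (\dim D)); move: {2}(\dim D) => m; elim: m D sD nD => [|m IH] D sD nD.
  by rewrite leqn0 => /eqP ->; rewrite mul0n leq_mul // potential_le.
have [->|/zeros_lt[x xZ]] := eqVneq D 0%VS.
  by move=> _; rewrite dimv0 mul0n leq_mul // potential_le.
move=> dimm; have sDC := subv_trans (shorten_sub D x) sD.
have dlt := dim_shorten_lt xZ; have dle := dim_shorten D x.
have nD' : (n <= K * #|zeros (shorten D x)|)%N.
  apply: leq_trans nD _; rewrite leq_mul //.
  by apply/subset_leq_card/zerosS/shorten_sub.
have := IH _ sDC nD' ltac:(lia); have := shorten_potential sD xZ; nia.
Qed.

Lemma zeros_le D : (#|zeros D| <= n)%N.
Proof. by rewrite -[leqRHS]card_ord max_card. Qed.

Section Real.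

Variables (R : realFieldType) (s : R).
Hypothesis s_ge0 : 0 <= s.
Hypothesis s_sqr : s ^+ 2 = n%:R.

(* [b ^+ G] stands for 2^(G/2n), up to a constant in the exponent. *)
Let b : R := 1 + (4 * n%:R)^-1.

Let n_gt0R : 0 < n%:R :> R.
Proof. by rewrite ltr0n. Qed.

Let b_ge1 : 1 <= b.
Proof. by rewrite lerDl invr_ge0 mulr_ge0 // ler0n. Qed.

Lemma base_pow2n : b ^+ (2 * n) <= 2.
Proof.
have := @bernoulli_le R (4 * n%:R)^-1 (2 * n).
rewrite invr_ge0 mulr_ge0 ?ler0n // -/b => /(_ isT).
have -> : 1 - (2 * n)%:R / (4 * n%:R) = 2^-1 :> R.
  by rewrite natrM; field; rewrite pnatr_eq0 -lt0n.
by move=> ?; lra.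
Qed.

(** With l the logarithm of the class size, [G] is at most n (l+1), and [b ^+ (2 * n)] is at most
    2. *)
Lemma base_pow_class D x G : (G <= potential D)%N ->
  (potential D <= n + n * trunc_log 2 #|agree D x|)%N ->
  b ^+ (2 * G) <= 2 * #|agree D x|%:R.
Proof.
move=> GD Dn; set l := trunc_log 2 #|agree D x| in Dn *.
have le_pow : (2 ^ l.+1 <= 2 * #|agree D x|)%N.
  by rewrite expnS leq_mul // trunc_logP // card_agree_gt0.
apply: (@le_trans _ _ (2 ^+ l.+1)); last first.
  by rewrite -natrX -[2 * _]natrM ler_nat.
apply: (@le_trans _ _ ((b ^+ (2 * n)) ^+ l.+1)).
  by rewrite -exprM; apply: ler_weXn2l => //; nia.
by rewrite lerXn2r ?base_pow2n // nnegrE ?exprn_ge0 // (le_trans ler01).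
Qed.

(** Preserves the invariant f >= sqrt n b^G: (f+m)^2 >= f^2 + 2fm >= (n+f) b^(2G), while n b^(2f) <=
    n + f for f <= n. *)
Lemma growth_step (f m G f' : nat) : (f <= n)%N ->
  b ^+ (2 * G) <= 2 * m%:R -> n%:R * b ^+ (2 * G) <= f%:R ^+ 2 :> R ->
  f' = (f + m)%N -> n%:R * b ^+ (2 * (G + f)) <= f'%:R ^+ 2 :> R.
Proof.
move=> fn bm nf ->; rewrite mulnDr exprD natrD.
have fn' : f%:R <= n%:R :> R by rewrite ler_nat.
have f0 := ler0n R f; have m0 := ler0n R m.
have nbf : n%:R * b ^+ (2 * f) <= n%:R + f%:R.
  have := @bernoulli_le R (4 * n%:R)^-1 (2 * f).
  rewrite invr_ge0 mulr_ge0 ?ler0n // -/b => /(_ isT).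
  set y := b ^+ _; have y0 : 0 <= y by rewrite exprn_ge0 // (le_trans ler01).
  have -> : 1 - (2 * f)%:R / (4 * n%:R) = (2 * n%:R - f%:R) / (2 * n%:R) :> R.
    by rewrite natrM; field; rewrite pnatr_eq0 -lt0n.
  rewrite mulrA ler_pdivrMr ?mul1r ?mulr_gt0 // => le_y.
  have npos := n_gt0R.
  rewrite -(@ler_pM2r _ (2 * n%:R - f%:R)); last by lra.
  have : 0 <= f%:R * (n%:R - f%:R) :> R by rewrite mulr_ge0 // subr_ge0.
  have : n%:R * (y * (2 * n%:R - f%:R)) <= n%:R * (2 * n%:R) by rewrite ler_wpM2l.
  by lra.
have y0 : 0 <= b ^+ (2 * G) by rewrite exprn_ge0 // (le_trans ler01).
have : b ^+ (2 * G) * (n%:R * b ^+ (2 * f)) <= b ^+ (2 * G) * (n%:R + f%:R).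
  by rewrite ler_wpM2l.
have : f%:R * b ^+ (2 * G) <= f%:R * (2 * m%:R) by rewrite ler_wpM2l.
have := sqr_ge0 (m%:R : R); rewrite mulrCA; lra.
Qed.

(** One shortening is paid for by the drop of 5 s / b^G when [G] grows by [f]. *)
Lemma growth_contract (f G : nat) (d : R) : (f <= n)%N ->
  n%:R * b ^+ (2 * G) <= f%:R ^+ 2 ->
  b ^+ (G + f) * d <= 5 * s -> b ^+ G * (d + 1) <= 5 * s.
Proof.
move=> fn nf; rewrite exprD.
have fn' : f%:R <= n%:R :> R by rewrite ler_nat.
have f0 := ler0n R f.
have bf : 4 * n%:R + f%:R <= 4 * n%:R * b ^+ f.
  have := @bernoulli_ge R (4 * n%:R)^-1 f.
  rewrite invr_ge0 mulr_ge0 ?ler0n // -/b => /(_ isT).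
  rewrite -(@ler_pM2l _ (4 * n%:R)) ?mulr_gt0 //; apply: le_trans.
  by rewrite mulrDr mulr1 mulrCA mulfV ?mulr1 // mulf_neq0 // gt_eqF.
have y0 : 0 < b ^+ G by rewrite exprn_gt0 // (lt_le_trans ltr01).
have z0 : 0 < b ^+ f by rewrite exprn_gt0 // (lt_le_trans ltr01).
have ny : n%:R * b ^+ G <= f%:R * s.
  rewrite -(@ler_pXn2r _ 2) // ?nnegrE ?mulr_ge0 ?(ltW y0) //.
  rewrite !exprMn s_sqr -exprM [(G * 2)%N]mulnC [leRHS]mulrC expr2 -mulrA.
  by rewrite ler_wpM2l ?ler0n.
set y := b ^+ G in y0 ny *; set z := b ^+ f in z0 bf *.
move=> yzd; rewrite -(@ler_pM2r _ z) //.
(* Here 1 - 1/z >= f/(4n+f) >= f/(5n), the source of the constant 5. *)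
have fz : f%:R * z <= 5 * n%:R * (z - 1).
  have : (5 * n%:R - f%:R) * (4 * n%:R + f%:R) <=
         (5 * n%:R - f%:R) * (4 * n%:R * z) :> R.
    by rewrite ler_wpM2l //; lra.
  have : 0 <= f%:R * (n%:R - f%:R) :> R by rewrite mulr_ge0 // subr_ge0.
  by move=> fnf zz; rewrite -(@ler_pM2l _ (4 * n%:R)) ?mulr_gt0 //; lra.
have yz : y * z <= 5 * s * (z - 1).
  rewrite -(@ler_pM2l _ n%:R) //.
  have : n%:R * y * z <= f%:R * s * z by rewrite ler_wpM2r // ltW.
  have : s * (f%:R * z) <= s * (5 * n%:R * (z - 1)) by rewrite ler_wpM2l.
  by lra.
by lra.
Qed.

(* [G] is the part of the potential accounted for by the growth of [zeros D];
   each shortening adds [#|zeros D|] to it, and [b ^- G] falls by at least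
   1 / (5 s), which bounds the number of shortenings. *)
Lemma dim_growth D G : (D <= C)%VS -> (G <= potential D)%N ->
  n%:R * b ^+ (2 * G) <= #|zeros D|%:R ^+ 2 :> R ->
  b ^+ G * ((\dim D)%:R - (K ^ 2)%:R) <= 5 * s.
Proof.
move: (leqnn (\dim D)); move: {2}(\dim D) => m.
have small D1 G1 : (\dim D1 <= K ^ 2)%N ->
    b ^+ G1 * ((\dim D1)%:R - (K ^ 2)%:R) <= 5 * s.
  move=> le_dim; apply: (@le_trans _ _ 0); last by rewrite mulr_ge0.
  by rewrite mulr_ge0_le0 ?exprn_ge0 ?(le_trans ler01) // subr_le0 ler_nat.
elim: m D G => [|m IH] D G.
  by rewrite leqn0 => /eqP dim0 _ _ _; apply: small; rewrite dim0.
move=> dimm sD GD nf.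
(* With many zeros the left side is nonpositive; otherwise they contribute less than [n] to the
   potential, as [base_pow_class] requires. *)
have [/(dim_many_zeros sD)/small //|few] := leqP n (K * #|zeros D|).
have [D0|/large_class[x xZ large]] := eqVneq D 0%VS.
  by apply: small; rewrite D0 dimv0.
have sDC := subv_trans (shorten_sub D x) sD.
have bm : b ^+ (2 * G) <= 2 * #|agree D x|%:R.
  by apply: base_pow_class => //; apply: leq_trans large _; rewrite leq_add2r ltnW.
have GD' : (G + #|zeros D| <= potential (shorten D x))%N.
  by apply: leq_trans (shorten_potential sD xZ); rewrite leq_add2r.
have nf' := growth_step (zeros_le D) bm nf (card_zeros_shorten xZ).
have dle := dim_shorten D x; have dlt := dim_shorten_lt xZ.
have dimm' : (\dim (shorten D x) <= m)%N by lia.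
have /(growth_contract (zeros_le D) nf) := IH _ _ dimm' sDC GD' nf'.
apply: le_trans.
rewrite ler_wpM2l ?exprn_ge0 ?(le_trans ler01) // addrAC lerD2r.
by rewrite natr1 ler_nat.
Qed.

(** Start-up phase: each shortening loses at most one dimension and adds at least one zero, so the
    sum does not fall. Once there are [s] zeros, [dim_growth] applies with G = 0; the shortening
    that crosses [s] costs the final 1. *)
Lemma dim_bound D : (D <= C)%VS -> #|zeros D|%:R < s ->
  (\dim D + #|zeros D|)%:R <= 6 * s + (K ^ 2)%:R + 1.
Proof.
move: (leqnn (\dim D)); move: {2}(\dim D) => m.
elim: m D => [|m IH] D.
  rewrite leqn0 => /eqP -> _ fs; rewrite add0n.
  by move: (K ^ 2)%:R (ler0n R (K ^ 2)) => k k0; have s0 := s_ge0; lra.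
move=> dimm sD fs; have [D0|/zeros_lt[x xZ]] := eqVneq D 0%VS.
  by rewrite {1}D0 dimv0 add0n; move: (K ^ 2)%:R (ler0n R (K ^ 2)) => k k0; have s0 := s_ge0; lra.
have sDC := subv_trans (shorten_sub D x) sD.
have dle := dim_shorten D x; have dlt := dim_shorten_lt xZ.
have cardZ := card_zeros_shorten xZ; have agree0 := card_agree_gt0 D x.
have dimm' : (\dim (shorten D x) <= m)%N by lia.
have [fs'|sf'] := ltP #|zeros (shorten D x)|%:R s.
  apply: le_trans (IH _ dimm' sDC fs'); rewrite ler_nat; lia.
have := dim_growth sDC (leq0n _).
rewrite muln0 !expr0 mulr1 mul1r -s_sqr lerXn2r ?nnegrE ?ler0n // => /(_ isT).
have : (\dim D)%:R <= (\dim (shorten D x)).+1%:R :> R by rewrite ler_nat.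
by rewrite natrD -natr1; move: (K ^ 2)%:R => k; have s0 := s_ge0; lra.
Qed.

End Real.
End Growth.

Theorem theorem1p4 (R : realType) :
  exists c : R, 0 < c /\
    forall (n : nat) (C : {vspace 'rV['F_2]_n}),
      (0 < n)%N -> perfect_lcc R 3 C ->
      (\dim C)%:R <= c * Num.sqrt (n%:R : R).
Proof.
(* 17 = 6 + 10 + 1: the bound 6 s + K^2 + 1 of [dim_bound], with K^2 <= 10 s and 1 <= s. *)
exists 17; split=> // n C n0 lccC.
have n0R : 0 < n%:R :> R by rewrite ltr0n.
have covered x : x \notin zeros C -> exists P, triple_cover C x P.
  move=> /nzerosP[c cC cx]; case: (lccC x) => [|[M [checksM]]].
    rewrite inE => /forallP/(_ c); rewrite cC /dotF2 (bigD1 x) //= big1.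
      by rewrite !mxE !eqxx cx.
    by move=> i ix; rewrite !mxE (negbTE ix) andbF mul0r.
  rewrite /perfect_density => leM; apply: (checks_triple_cover checksM).
  rewrite -(ler_nat R) -natr1 natrM.
  have : (n%:R - 1) / (3 * n%:R) * n%:R = (n%:R - 1) / 3 :> R.
    by field; rewrite gt_eqF.
  by move: leM => /[swap] ->; lra.
move: (sqrtr_ge0 (n%:R : R)) (sqr_sqrtr (ltW n0R)).
move: (Num.sqrt n%:R) => s s0 s_sqr.
have s1 : 1 <= s.
  by rewrite -(@ler_pXn2r _ 2) ?nnegrE // s_sqr expr1n (ler_nat R 1).
have K10 : ((trunc_log 2 n).+2 ^ 2)%:R <= 10 * s.
  rewrite -(@ler_pXn2r _ 2) ?nnegrE ?mulr_ge0 // exprMn s_sqr -!natrX -natrM.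
  by rewrite ler_nat -expnM pow4_trunc_log.
have [Zs|sZ] := ltP #|zeros C|%:R s.
  move: (dim_bound n0 covered s0 s_sqr (subvv C) Zs) (ler0n R #|zeros C|) K10.
  by rewrite natrD; move: (_ ^ 2)%:R => k; lra.
have := dim_growth n0 covered s0 s_sqr (subvv C) (leq0n _).
rewrite muln0 !expr0 mulr1 mul1r -s_sqr lerXn2r ?nnegrE ?ler0n // => /(_ isT).
by move: (_ ^ 2)%:R K10 => k; lra.
Qed.
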